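(* Let $s,t,r$ be positive integers with $r\ge s$. An SBP operator with parameters $(s,t,r)$ exists if and only if there is a symmetric positive definite matrix $\tilde P=(\tilde P_{k\ell})_{k,\ell=0}^{r-1}\in\mathbb{R}^{r\times r}$ satisfying $$\sum_{k=0}^{r-1}\sum_{\ell=0}^{r-1}\left(q\,k^p\ell^{q-1}+p\,k^q\ell^{p-1}\right)\tilde P_{k\ell}=\sum_{k=0}^{r-1}\sum_{\ell=0}^{s-1}\left(k^p(r+\ell)^q+k^q(r+\ell)^p\right)C_{k\ell}-\delta_{p0}\delta_{q0}$$ for every $p=0,1,\ldots,t$ and $q=p,p+1,\ldots,t$.
   Context: All vectors and matrices are indexed starting from $0$. Conventions: $0^0=1$, and any term of the form $j\,x^{j-1}$ with $j=0$ equals $0$ (also when $x=0$). $\delta$ is the Kronecker delta. Centered stencil: $\alpha_1,\dots,\alpha_s$ are the coefficients of the standard centered finite difference approximation of the first derivative of order $2s$ with unit step, $f'(x)\approx\sum_{j=1}^s\alpha_j\,(f(x+j)-f(x-j))$; explicitly $\alpha_j=\dfrac{(-1)^{j+1}(s!)^2}{j\,(s-j)!\,(s+j)!}$. The matrix $C\in\mathbb{R}^{r\times s}$ is defined by $C_{k\ell}=\alpha_{r+\ell-k}$ if $1\le r+\ell-k\le s$ and $C_{k\ell}=0$ otherwise ($0\le k\le r-1$, $0\le\ell\le s-1$). SBP operator with parameters $(s,t,r)$ (unit step size) on $n\ge 2r+s$ grid points $0,1,\dots,n-1$: a pair of matrices $P,D\in\mathbb{R}^{n\times n}$ such that (1)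 $P=\mathrm{diag}(\tilde P,I_{n-2r},\hat P)$ is block diagonal with $\tilde P,\hat P\in\mathbb{R}^{r\times r}$ symmetric positive definite. (2) For each interior row $i=r,\dots,n-r-1$: $D_{i,i+j}=\alpha_j$ and $D_{i,i-j}=-\alpha_j$ for $1\le j\le s$, and all other entries of row $i$ are $0$. (3) The first $r$ and last $r$ rows of $D$ are finite difference approximations of the first derivative of order $t$: for each such row $i$ and each $m=0,1,\dots,t$, $\sum_{j=0}^{n-1}D_{ij}\,j^m=m\,i^{m-1}$. (4) The energy condition $PD+D^TP=e_{n-1}e_{n-1}^T-e_0e_0^T$ holds, where $e_0,\dots,e_{n-1}$ is the canonical basis of $\mathbb{R}^n$. (5) $D$ has the form $$D=\begin{bmatrix}\tilde P^{-1}&0&0\\0&I&0\\0&0&\hat P^{-1}\end{bmatrix}\begin{bmatrix}B&C_0&0\\-C_0^T&\tilde D&-\hat C_0^T\\0&\hat C_0&\hat B\end{bmatrix}$$ with $B,\hat B\in\mathbb{R}^{r\times r}$, $C_0=[\,C\;\;0\,]$ and $\hat C_0=[\,0\;\;\hat C\,]$ in $\mathbb{R}^{r\times(n-2r)}$, where $\hat C\in\mathbb{R}^{r\times s}$ (the blocks $C_0,\tilde D,\hat C_0$ are determined by the interior rows in (2)). We say an SBP operator with parameters $(s,t,r)$ exists if such a pair exists for every $n\ge 2r+s$. *)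

(* Defs.v *)
From HB Require Import structures.
From mathcomp Require Import all_boot all_order all_algebra.
From mathcomp Require Import reals.

Set Implicit Arguments.
Unset Strict Implicit.
Unset Printing Implicit Defensive.

Import Order.TTheory GRing.Theory Num.Theory.

Local Open Scope ring_scope.

Definition spd_mx (R : realType) (r : nat) (A : 'M[R]_r) : Prop :=
  A^T = A /\ forall x : 'cV[R]_r, x != 0 -> 0 < (x^T *m A *m x) 0 0.

(* Only meaningful, and only used, for 1 <= j <= s. *)
Definition stencil_coef (R : realType) (s j : nat) : R :=
  (-1) ^+ j.+1 * (s`!)%:R ^+ 2 / (j%:R * ((s - j)`!)%:R * ((s + j)`!)%:R).

Definition interior_entry (R : realType) (s i c : nat) : R :=
  if (i < c <= i + s)%N then stencil_coef R s (c - i)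
  else if (c < i <= c + s)%N then - stencil_coef R s (i - c)
  else 0.

(* Since k < r, the subtraction r + l - k on nat is never truncated. *)
Definition coupling_mx (R : realType) (s r : nat) : 'M[R]_(r, s) :=
  \matrix_(k < r, l < s)
    if (1 <= r + l - k <= s)%N then stencil_coef R s (r + l - k) else 0.

(* A basis vector with a nat index, so that e_0 and e_(n-1) make sense for an n
   that is not syntactically a successor; it is 0 when n <= i. *)
Definition basis_col (R : realType) (n i : nat) : 'cV[R]_n :=
  \col_(j < n) ((j : nat) == i)%:R.

Definition block3_mx (R : realType) (a b c : nat)
    (A00 : 'M[R]_(a, a)) (A01 : 'M[R]_(a, b)) (A02 : 'M[R]_(a, c))
    (A10 : 'M[R]_(b, a)) (A11 : 'M[R]_(b, b)) (A12 : 'M[R]_(b, c))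
    (A20 : 'M[R]_(c, a)) (A21 : 'M[R]_(c, b)) (A22 : 'M[R]_(c, c)) :
    'M[R]_(a + (b + c)) :=
  block_mx A00 (row_mx A01 A02)
           (col_mx A10 A20) (block_mx A11 A12 A21 A22).

Lemma sbp_dim (s r n : nat) (hn : (2 * r + s <= n)%N) :
  (r + ((n - 2 * r) + r) = n)%N.
Proof.
by rewrite addnCA addnn -mul2n subnK // (leq_trans (leq_addr s _) hn).
Qed.

Lemma left_dim (s r n : nat) (hn : (2 * r + s <= n)%N) :
  (s + (n - 2 * r - s) = n - 2 * r)%N.
Proof. by rewrite subnKC // leq_subRL // (leq_trans (leq_addr s _) hn). Qed.

Lemma right_dim (s r n : nat) (hn : (2 * r + s <= n)%N) :
  ((n - 2 * r - s) + s = n - 2 * r)%N.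
Proof. by rewrite addnC (left_dim hn). Qed.

(* The matrices [C 0] and [0 C] with n - 2r columns. *)
Definition pad_right (R : realType) (s r n : nat) (hn : (2 * r + s <= n)%N)
    (C : 'M[R]_(r, s)) : 'M[R]_(r, n - 2 * r) :=
  castmx (erefl r, left_dim hn) (row_mx C (0 : 'M[R]_(r, n - 2 * r - s))).

Definition pad_left (R : realType) (s r n : nat) (hn : (2 * r + s <= n)%N)
    (C : 'M[R]_(r, s)) : 'M[R]_(r, n - 2 * r) :=
  castmx (erefl r, right_dim hn) (row_mx (0 : 'M[R]_(r, n - 2 * r - s)) C).

(* In the accuracy condition, m%:R * x ^+ m.-1 is 0 for m = 0 and x ^+ 0 = 1
   also at x = 0. *)
Definition is_SBP (R : realType) (s t r n : nat) (hn : (2 * r + s <= n)%N)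
    (P D : 'M[R]_n) : Prop :=
  exists Pt Ph : 'M[R]_r,
  [/\ [/\ spd_mx Pt, spd_mx Ph &
          P = castmx (sbp_dim hn, sbp_dim hn)
                (block3_mx Pt 0    0
                           0  1%:M 0
                           0  0    Ph)],
      forall i c : 'I_n, (r <= i < n - r)%N -> D i c = interior_entry R s i c,
      forall i : 'I_n, (i < r)%N || (n - r <= i)%N ->
        forall m : nat, (m <= t)%N ->
          \sum_(j < n) D i j * (j%:R : R) ^+ m = m%:R * (i%:R : R) ^+ m.-1,
      P *m D + D^T *m P =
        basis_col R n n.-1 *m (basis_col R n n.-1)^T
        - basis_col R n 0 *m (basis_col R n 0)^T &
      exists (B Bh : 'M[R]_r) (Ch : 'M[R]_(r, s)) (Dt : 'M[R]_(n - 2 * r)),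
        let C0 := pad_right hn (coupling_mx R s r) in
        let Ch0 := pad_left hn Ch in
        D = castmx (sbp_dim hn, sbp_dim hn)
              (block3_mx (invmx Pt) 0    0
                         0          1%:M 0
                         0          0    (invmx Ph)
               *m
               block3_mx B         C0  0
                         (- C0^T)  Dt  (- Ch0^T)
                         0         Ch0 Bh)].

Definition SBP_exists (R : realType) (s t r : nat) : Prop :=
  forall (n : nat) (hn : (2 * r + s <= n)%N),
    exists P D : 'M[R]_n, is_SBP t hn P D.

(* Main.v *)
Require Import Defs.
From HB Require Import structures.
From mathcomp Require Import all_boot all_order all_algebra.
From mathcomp Require Import reals ring zify.

Set Implicit Arguments.
Unset Strict Implicit.
Unset Printing Implicit Defensive.

Import Order.TTheory GRing.Theory Num.Theory.

Local Open Scope ring_scope.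

(** Multiplying by P turns the SBP conditions into conditions on M = P D, which
    is explicit away from its two r x r corner blocks B and Bh. Since the interior
    stencil is antisymmetric, M + M^T vanishes outside the corners, so the
    energy condition only says that B + B^T = - e_0 e_0^T (and the analogue for
    Bh). With V the Vandermonde matrix of the left boundary points 0, ..., r-1,
    W that of the points r, ..., r+s-1 and V' the derivatives of the monomials
    on the boundary points, accuracy of the first r rows reads
    B V + C W = Pt V'. These two conditions on B form [boundary_closure].

    For fixed Pt, put G = Pt V' - C W. If B exists, then
    V^T G + (V^T G)^T = V^T (B + B^T) V = - (V^T e_0) (V^T e_0)^T,
    and the (p, q) entry of this identity is exactly the moment condition for p
    and q. Conversely, the equation B V = G with prescribed symmetric part of B
    is solvable as soon as this compatibility identity holds, because a
    Vandermonde matrix has full rank ([mx_with_sym_part],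
    [monomial_samples_rank], [boundary_closureP]).

    The right boundary brings no new condition: the reflection x -> n - 1 - x
    reverses the sign of the derivative and of the stencil, so the point
    reflections of Pt, - B and - C close the operator on the right
    ([boundary_closure_flip]). Since B does not involve n, one closure serves
    all grids, while a single grid (here the smallest) suffices to extract
    it. *)

(** * Solving for a matrix with prescribed symmetric part *)

(** The symmetric part is split off, which leaves A V = H with A skew and
    V^T H skew. With N a pseudo-inverse of V, the matrix
    H N - (H N)^T + N^T H^T V N is skew and solves it, provided the rows of H
    lie in the row space of V. The rank hypothesis guarantees the latter:
    trivially if V has full column rank, and otherwise because V^T, being
    injective, can be cancelled from V^T H = - H^T V, whose right-hand side has
    its rows in the row space of V. *)
Lemma mx_with_sym_part (F : numFieldType) (r T : nat)
    (V G : 'M[F]_(r, T)) (S : 'M[F]_r) :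
  row_free V || row_full V -> S^T = S ->
  V^T *m G + (V^T *m G)^T = V^T *m S *m V ->
  exists B : 'M[F]_r, B + B^T = S /\ B *m V = G.
Proof.
move=> rankV symS compat.
pose hS := 2^-1 *: S; pose H := G - hS *m V; pose N := pinvmx V.
have hS2 : hS + hS = S by rewrite -scalerDl -[2^-1]mul1r -splitr scale1r.
have hST : hS^T = hS by rewrite /hS linearZ /= symS.
have skewH : H^T *m V = - (V^T *m H).
  apply/eqP; rewrite -addr_eq0; apply/eqP.
  rewrite -[X in X + _]trmxK trmx_mul trmxK addrC mulmxBr linearB /= addrACA.
  rewrite compat -opprD !trmx_mul trmxK hST mulmxA -mulmxDl -mulmxDr hS2.
  by rewrite subrr.
have VNV : V *m N *m V = V by rewrite mulmxKpV.
have HNV : H *m N *m V = H.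
  case/orP: rankV => [freeV|fullV]; last by rewrite mulmxKpV ?submx_full.
  have cancelVt (X : 'M_(r, T)) : X = N^T *m (V^T *m X).
    by rewrite mulmxA -trmx_mul mulmxVp // trmx1 mul1mx.
  rewrite [LHS]cancelVt [RHS]cancelVt; congr (_ *m _).
  rewrite -[RHS]opprK -skewH -[in RHS]VNV !mulmxA skewH.
  by rewrite !mulNmx opprK.
clearbody N.
pose K := N^T *m H^T *m V *m N.
have skewK : K^T = - K.
  rewrite {1}/K -(mulmxA N^T) skewH mulmxN mulNmx linearN /= !trmx_mul !trmxK.
  by rewrite /K !mulmxA.
pose A := H *m N - (H *m N)^T + K.
exists (hS + A); split.
  rewrite linearD /= hST addrACA hS2 /A linearD linearB /= skewK trmxK.
  by rewrite addrACA subrr addr0 -opprB addNr addr0.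
rewrite (mulmxDl hS) (mulmxDl (_ - _) K) mulmxBl HNV trmx_mul -!mulmxA.
rewrite [V *m (N *m V)]mulmxA VNV.
by rewrite subrK /H addrC subrK.
Qed.

(** * Polynomials sampled on the grid *)

(** The grid points are a, a + 1, ..., a + N - 1. *)
Definition monomial_samples (R : nzRingType) (t a N : nat) : 'M[R]_(N, t.+1) :=
  \matrix_(j, m) (a + j)%:R ^+ m.

Definition deriv_samples (R : nzRingType) (t a N : nat) : 'M[R]_(N, t.+1) :=
  \matrix_(j, m) (m%:R * (a + j)%:R ^+ m.-1).

Definition poly_samples (R : nzRingType) (a N : nat) (p : {poly R}) : 'cV[R]_N :=
  \col_j p.[(a + j)%:R].

Lemma monomial_samples_unit (F : numFieldType) (t : nat) :
  monomial_samples F t 0 t.+1 \in unitmx.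
Proof.
rewrite -unitmx_tr.
have -> : (monomial_samples F t 0 t.+1)^T = Vandermonde t.+1 (\row_j j%:R).
  by apply/matrixP => i j; rewrite !mxE.
rewrite unitmxE det_Vandermonde unitfE.
apply/prodf_neq0 => i _; apply/prodf_neq0 => j ltij.
by rewrite !mxE subr_eq0 eqr_nat neq_ltn ltij orbT.
Qed.

(** The number of points r and of monomials t + 1 are unrelated, so either may
    be the rank; a square Vandermonde submatrix is invertible in both cases. *)
Lemma monomial_samples_rank (F : numFieldType) (t r : nat) :
  row_free (monomial_samples F t 0 r) || row_full (monomial_samples F t 0 r).
Proof.
case: (leqP t.+1 r) => [letr|ltrt].
- apply/orP; right; have := monomial_samples_unit F t; rewrite -row_full_unit.
  rewrite -!col_leq_rank => /leq_trans; apply.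
  rewrite (_ : monomial_samples F t 0 t.+1 =
    rowsub (widen_ord letr) (monomial_samples F t 0 r)).
    by rewrite rowsubE mxrankM_maxr.
  by apply/matrixP => i j; rewrite !mxE.
- apply/orP; left; case: r ltrt => [_|r ltrt].
    by rewrite -row_leq_rank.
  have := monomial_samples_unit F r; rewrite -row_free_unit.
  rewrite -!row_leq_rank => /leq_trans; apply.
  rewrite (_ : monomial_samples F r 0 r.+1 =
    monomial_samples F t 0 r.+1 *m colsub (widen_ord (ltnW ltrt)) 1%:M).
    by rewrite mxrankM_maxl.
  by rewrite mulmx_colsub mulmx1; apply/matrixP => i j; rewrite !mxE.
Qed.

Lemma poly_samplesE (R : comNzRingType) (t a N : nat) (p : {poly R}) :
  (size p <= t.+1)%N ->
  poly_samples a N p = monomial_samples R t a N *m \col_m p`_m.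
Proof.
move=> szp; apply/matrixP => j k; rewrite !mxE (horner_coef_wide _ szp).
by apply: eq_bigr => m _; rewrite !mxE mulrC.
Qed.

Lemma poly_samples_deriv (R : comNzRingType) (t a N : nat) (p : {poly R}) :
  (size p <= t.+1)%N ->
  poly_samples a N p^`() = deriv_samples R t a N *m \col_m p`_m.
Proof.
move=> szp; apply/matrixP => j k; rewrite !mxE.
rewrite -[p in LHS](coefK p) poly_def linear_sum horner_sum.
rewrite (big_ord_widen _ (fun m => (p`_m *: 'X^m)^`().[(a + j)%:R]) szp).
rewrite big_mkcond /=; apply: eq_bigr => m _.
rewrite !mxE; case: ltnP => [_|lepm]; last by rewrite nth_default ?mulr0.
rewrite derivZ derivXn hornerZ hornerMn hornerXn mulr_natl mulrC.
by rewrite mulrnAl.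
Qed.

(** * Point reflection of matrices *)

Definition flip_mx (R : Type) (m n : nat) (A : 'M[R]_(m, n)) : 'M[R]_(m, n) :=
  mxsub (@rev_ord m) (@rev_ord n) A.

Lemma flip_mxK (R : Type) (m n : nat) : involutive (@flip_mx R m n).
Proof. by move=> A; apply/matrixP => i j; rewrite !mxE !rev_ordK. Qed.

Lemma flip_mxM (R : nzRingType) (m n p : nat) (A : 'M[R]_(m, n))
    (B : 'M[R]_(n, p)) : flip_mx (A *m B) = flip_mx A *m flip_mx B.
Proof.
apply/matrixP => i j; rewrite !mxE (reindex_inj rev_ord_inj) /=.
by apply: eq_bigr => k _; rewrite !mxE.
Qed.

Lemma tr_flip_mx (R : Type) (m n : nat) (A : 'M[R]_(m, n)) :
  (flip_mx A)^T = flip_mx A^T.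
Proof. by apply/matrixP => i j; rewrite !mxE. Qed.

(** The origin b of the reflected grid is free: it is compensated by the choice
    of the reflection, which exchanges a and b + N - 1. *)
Lemma flip_poly_samples (R : comNzRingType) (a b N : nat) (p : {poly R}) :
  flip_mx (poly_samples a N p) =
  poly_samples b N (p \Po ((a + b + N)%:R%:P - 1 - 'X)).
Proof.
apply/matrixP => i j; rewrite !mxE horner_comp !hornerE /=; congr (_.[_]).
rewrite natrD natrB ?ltn_ord // -addn1 !natrD.
by ring.
Qed.

(** * Symmetric positive definite matrices *)

Lemma spd_mx_unit (R : realType) (r : nat) (A : 'M[R]_r) :
  spd_mx A -> A \in unitmx.
Proof.
case=> _ posA; rewrite -row_free_unit; apply: inj_row_free => v vA0.
apply/eqP; case: (eqVneq v 0) => // nzv.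
have := posA v^T; rewrite trmxK vA0 mul0mx mxE ltxx; apply.
by rewrite trmx_eq0.
Qed.

Lemma spd_mx_flip (R : realType) (r : nat) (A : 'M[R]_r) :
  spd_mx A -> spd_mx (flip_mx A).
Proof.
case=> symA posA; split=> [|x nzx]; first by rewrite tr_flip_mx symA.
rewrite -[x]flip_mxK tr_flip_mx -!flip_mxM !mxE.
have /posA : flip_mx x != 0.
  apply: contra_neq nzx => fx0; rewrite -[x]flip_mxK fx0.
  by apply/matrixP => i j; rewrite !mxE.
by rewrite mxE !ord1.
Qed.

(** * Block decomposition *)

Lemma monomial_samples_cat (R : nzRingType) (t a m n : nat) :
  monomial_samples R t a (m + n) =
  col_mx (monomial_samples R t a m) (monomial_samples R t (a + m) n).
Proof.
apply/matrixP => i j; case: (split_ordP i) => k ->.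
  by rewrite col_mxEu !mxE.
by rewrite col_mxEd !mxE /= addnA.
Qed.

Lemma basis_col_lshift (R : realType) (m n i : nat) : (i < m)%N ->
  basis_col R (m + n) i = col_mx (basis_col R m i) 0.
Proof.
move=> ltim; apply/matrixP => k j; case: (split_ordP k) => l ->.
  by rewrite col_mxEu !mxE.
by rewrite col_mxEd !mxE /= gtn_eqF // ltn_addr.
Qed.

Lemma basis_col_rshift (R : realType) (m n i : nat) :
  basis_col R (m + n) (m + i) = col_mx 0 (basis_col R n i).
Proof.
apply/matrixP => k j; case: (split_ordP k) => l ->.
  by rewrite col_mxEu !mxE /= ltn_eqF // ltn_addr.
by rewrite col_mxEd !mxE /= eqn_add2l.
Qed.

(** Samples are defined for every number N of points, so that a cast of their
    dimension amounts to a change of N. *)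
Lemma castmx_row_mulmx (R : pzRingType) (m n n' k : nat) (e : n = n')
    (A : 'M[R]_(m, n)) (X : forall N : nat, 'M[R]_(N, k)) :
  castmx (erefl m, e) A *m X n' = A *m X n.
Proof. by case: n' / e; rewrite castmx_id. Qed.

Lemma block3_mul_col (R : realType) (a b c k : nat)
    (A00 : 'M[R]_(a, a)) (A01 : 'M[R]_(a, b)) (A02 : 'M[R]_(a, c))
    (A10 : 'M[R]_(b, a)) (A11 : 'M[R]_(b, b)) (A12 : 'M[R]_(b, c))
    (A20 : 'M[R]_(c, a)) (A21 : 'M[R]_(c, b)) (A22 : 'M[R]_(c, c))
    (x : 'M[R]_(a, k)) (y : 'M[R]_(b, k)) (z : 'M[R]_(c, k)) :
  block3_mx A00 A01 A02 A10 A11 A12 A20 A21 A22 *m col_mx x (col_mx y z) =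
  col_mx (A00 *m x + (A01 *m y + A02 *m z))
         (col_mx (A10 *m x + (A11 *m y + A12 *m z))
                 (A20 *m x + (A21 *m y + A22 *m z))).
Proof.
by rewrite /block3_mx mul_block_col mul_row_col mul_col_mx mul_block_col
           add_col_mx.
Qed.

Lemma block3_diag_mul (R : realType) (a b c : nat)
    (X : 'M[R]_a) (Y : 'M[R]_b) (Z : 'M[R]_c)
    (A00 : 'M[R]_(a, a)) (A01 : 'M[R]_(a, b)) (A02 : 'M[R]_(a, c))
    (A10 : 'M[R]_(b, a)) (A11 : 'M[R]_(b, b)) (A12 : 'M[R]_(b, c))
    (A20 : 'M[R]_(c, a)) (A21 : 'M[R]_(c, b)) (A22 : 'M[R]_(c, c)) :
  block3_mx X 0 0 0 Y 0 0 0 Z *m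
  block3_mx A00 A01 A02 A10 A11 A12 A20 A21 A22 =
  block3_mx (X *m A00) (X *m A01) (X *m A02)
            (Y *m A10) (Y *m A11) (Y *m A12)
            (Z *m A20) (Z *m A21) (Z *m A22).
Proof.
rewrite /block3_mx row_mx0 col_mx0 mulmx_block !mul0mx !addr0 !add0r.
by rewrite mul_mx_row mul_block_col mulmx_block !mul0mx !addr0 !add0r.
Qed.

Lemma tr_block3_mx (R : realType) (a b c : nat)
    (A00 : 'M[R]_(a, a)) (A01 : 'M[R]_(a, b)) (A02 : 'M[R]_(a, c))
    (A10 : 'M[R]_(b, a)) (A11 : 'M[R]_(b, b)) (A12 : 'M[R]_(b, c))
    (A20 : 'M[R]_(c, a)) (A21 : 'M[R]_(c, b)) (A22 : 'M[R]_(c, c)) :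
  (block3_mx A00 A01 A02 A10 A11 A12 A20 A21 A22)^T =
  block3_mx A00^T A10^T A20^T A01^T A11^T A21^T A02^T A12^T A22^T.
Proof. by rewrite /block3_mx !tr_block_mx tr_row_mx tr_col_mx. Qed.

(** The couplings between boundary and interior enter P D antisymmetrically, so
    they cancel from the energy condition. *)
Lemma energy_block3 (R : realType) (r b : nat) (B Bh : 'M[R]_r)
    (C0 Ch0 : 'M[R]_(r, b)) (Dt : 'M[R]_b) :
  let M := block3_mx B C0 0 (- C0^T) Dt (- Ch0^T) 0 Ch0 Bh in
  M + M^T = block_mx (B + B^T) 0 0 (block_mx (Dt + Dt^T) 0 0 (Bh + Bh^T)).
Proof.
rewrite /= tr_block3_mx /block3_mx !add_block_mx add_row_mx add_col_mx.
by rewrite !linearN /= !trmxK !trmx0 !subrr !addNr !addr0 row_mx0 col_mx0.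
Qed.

Lemma energy_corners (R : realType) (r b : nat) : (0 < r)%N ->
  let n := (r + (b + r))%N in
  basis_col R n n.-1 *m (basis_col R n n.-1)^T
  - basis_col R n 0 *m (basis_col R n 0)^T =
  block_mx (- (basis_col R r 0 *m (basis_col R r 0)^T)) 0 0
    (block_mx 0 0 0 (basis_col R r r.-1 *m (basis_col R r r.-1)^T)).
Proof.
move=> r0 /=; have -> : (r + (b + r)).-1 = (r + (b + r.-1))%N by lia.
rewrite (basis_col_lshift _ _ r0) !basis_col_rshift !tr_col_mx !mul_col_row.
rewrite !trmx0 !mulmx0 !mul0mx opp_block_mx add_block_mx.
by rewrite !oppr0 !addr0 !add0r.
Qed.

(** * Closing the left boundary *)

(** B is the upper left block of P D; the two conditions are the energy
    condition and accuracy of order t, restricted to the first r rows. *)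
Definition boundary_closure (R : realType) (s t r : nat) (Pt B : 'M[R]_r) :=
  B + B^T = - (basis_col R r 0 *m (basis_col R r 0)^T) /\
  B *m monomial_samples R t 0 r +
    coupling_mx R s r *m monomial_samples R t r s =
  Pt *m deriv_samples R t 0 r.

Definition moment_conditions (R : realType) (s t r : nat) (Pt : 'M[R]_r) :=
  forall p q : nat, (p <= q)%N -> (q <= t)%N ->
      \sum_(k < r) \sum_(l < r)
        (q%:R * k%:R ^+ p * l%:R ^+ q.-1 + p%:R * k%:R ^+ q * l%:R ^+ p.-1)
          * Pt k l
      = \sum_(k < r) \sum_(l < s)
          (k%:R ^+ p * (r + l)%:R ^+ q + k%:R ^+ q * (r + l)%:R ^+ p)
            * coupling_mx R s r k l
        - (p == 0%N)%:R * (q == 0%N)%:R.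

(** The moment conditions are the compatibility condition of
    [mx_with_sym_part] written out entry by entry. Their right-hand side
    - delta_p0 delta_q0 arises since V^T e_0, the monomials at 0, is the first
    basis vector. *)
Lemma moment_conditionsE (R : realType) (s t r : nat) (Pt : 'M[R]_r) :
  let V := monomial_samples R t 0 r in
  let G := Pt *m deriv_samples R t 0 r -
           coupling_mx R s r *m monomial_samples R t r s in
  (0 < r)%N ->
  moment_conditions s t Pt <->
  V^T *m G + (V^T *m G)^T =
  V^T *m - (basis_col R r 0 *m (basis_col R r 0)^T) *m V.
Proof.
move=> V G r0.
have VtGE (p q : 'I_t.+1) : (V^T *m G) p q =
    \sum_(k < r) \sum_(l < r) q%:R * k%:R ^+ p * l%:R ^+ q.-1 * Pt k l -
    \sum_(k < r) \sum_(l < s) k%:R ^+ p * (r + l)%:R ^+ q *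
       coupling_mx R s r k l.
  rewrite -sumrB mxE; apply: eq_bigr => k _.
  rewrite mxE [V k p]mxE add0n mxE [in X in _ * (_ + X)]mxE mulrBr !mxE.
  rewrite !mulr_sumr; congr (_ - _); apply: eq_bigr => l _; rewrite !mxE;
  by ring.
have Ve : V^T *m basis_col R r 0 = basis_col R t.+1 0.
  apply/matrixP => p j; rewrite !mxE (bigD1 (Ordinal r0)) //= !mxE eqxx mulr1.
  rewrite expr0n big1 ?addr0 // => k; rewrite -val_eqE /= => nk0.
  by rewrite !mxE (negbTE nk0) mulr0.
have eVE (p q : 'I_t.+1) :
    (V^T *m - (basis_col R r 0 *m (basis_col R r 0)^T) *m V) p q =
    - ((p == 0%N :> nat)%:R * (q == 0%N :> nat)%:R).
  rewrite mulmxN mulNmx mulmxA Ve -mulmxA -[V in LHS]trmxK -trmx_mul Ve.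
  by rewrite !mxE big_ord1 !mxE.
have entryE (p q : 'I_t.+1) :
    (V^T *m G + (V^T *m G)^T) p q =
    \sum_(k < r) \sum_(l < r)
        (q%:R * k%:R ^+ p * l%:R ^+ q.-1 + p%:R * k%:R ^+ q * l%:R ^+ p.-1)
          * Pt k l
    - \sum_(k < r) \sum_(l < s)
          (k%:R ^+ p * (r + l)%:R ^+ q + k%:R ^+ q * (r + l)%:R ^+ p)
            * coupling_mx R s r k l.
  rewrite mxE [(V^T *m G)^T p q]mxE !VtGE addrACA -opprD -!big_split /=.
  congr (_ - _); apply: eq_bigr => k _; rewrite -big_split /=;
  by apply: eq_bigr => l _; rewrite mulrDl.
have symE (N : 'M[R]_t.+1) i j : (N + N^T) i j = (N + N^T) j i.
  by rewrite [LHS]mxE [RHS]mxE [N^T i j]mxE [N^T j i]mxE addrC.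
split=> [mom|eqV p q lepq leqt].
  apply/matrixP.
  suff le_case (p q : 'I_t.+1) : (p <= q)%N ->
      (V^T *m G + (V^T *m G)^T) p q =
      (V^T *m - (basis_col R r 0 *m (basis_col R r 0)^T) *m V) p q.
    move=> p q; case: (leqP p q) => [/le_case //|/ltnW/le_case].
    rewrite !eVE mulrC => <-.
    by rewrite symE.
  move=> lepq; rewrite entryE eVE (mom p q lepq (leq_ord q)).
  by rewrite addrAC subrr sub0r.
have lept := leq_trans lepq leqt.
have := congr1 (fun A : 'M_t.+1 => A (Ordinal (lept : p < t.+1)%N)
                                     (Ordinal (leqt : q < t.+1)%N)) eqV.
by rewrite /= entryE eVE /= => /eqP; rewrite subr_eq addrC => /eqP.
Qed.

Lemma boundary_closureP (R : realType) (s t r : nat) (Pt : 'M[R]_r) :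
  (0 < r)%N ->
  (exists B, boundary_closure s t Pt B) <-> moment_conditions s t Pt.
Proof.
move=> r0; rewrite moment_conditionsE //; split=> [[B [symB /eqP]]|compat].
  rewrite -subr_eq0 -addrA; rewrite addr_eq0 opprB => /eqP <-.
  by rewrite -symB mulmxA !trmx_mul trmxK mulmxDr mulmxDl !mulmxA.
have [] := mx_with_sym_part (monomial_samples_rank R t r) _ compat.
  by rewrite linearN /= trmx_mul trmxK.
by move=> B [symB BV]; exists B; split; rewrite // BV subrK.
Qed.

(** * Closing the right boundary *)

(** Apply the left closure to the polynomial p(K - x), where the reflection
    x -> K - x maps the right boundary onto the left one. The chain rule
    produces the sign that is absorbed by negating B and C. *)
Lemma boundary_closure_flip (R : realType) (s t r a : nat) (Pt B : 'M[R]_r) :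
  boundary_closure s t Pt B ->
  - flip_mx (coupling_mx R s r) *m monomial_samples R t a s +
    - flip_mx B *m monomial_samples R t (a + s) r =
  flip_mx Pt *m deriv_samples R t (a + s) r.
Proof.
case=> _ accB.
have acc (p : {poly R}) : (size p <= t.+1)%N ->
    B *m poly_samples 0 r p + coupling_mx R s r *m poly_samples r s p =
    Pt *m poly_samples 0 r p^`().
  move=> szp; rewrite !(poly_samplesE _ _ szp) (poly_samples_deriv _ _ szp).
  by rewrite !mulmxA -accB mulmxDl.
(* Column m of the matrix identity is its instance at the monomial X^m. *)
apply/matrixP => i m.
pose p : {poly R} := 'X^m; have szp : (size p <= t.+1)%N by rewrite size_polyXn.
have pE : \col_j p`_j = delta_mx m 0 :> 'cV[R]_t.+1.
  by apply/matrixP => j k; rewrite !mxE coefXn ord1 eqxx andbT.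
suff: - flip_mx (coupling_mx R s r) *m poly_samples a s p +
      - flip_mx B *m poly_samples (a + s) r p =
      flip_mx Pt *m poly_samples (a + s) r p^`().
  rewrite !(poly_samplesE _ _ szp) (poly_samples_deriv _ _ szp) pE.
  rewrite !mulmxA -mulmxDl -!colE => /matrixP/(_ i 0).
  by rewrite [LHS]mxE [RHS]mxE.
pose u : {poly R} := (a + s + r)%:R%:P - 1 - 'X.
have szpu : (size (p \Po u) <= t.+1)%N.
  rewrite size_comp_poly2 // /u -opprB size_polyN -polyC1 -rmorphB /=.
  by rewrite size_XsubC.
apply: (can_inj (@flip_mxK _ _ _)).
have flipD (A A' : 'cV[R]_r) : flip_mx (A + A') = flip_mx A + flip_mx A'.
  exact: linearD.
have flipN (A : 'cV[R]_r) : flip_mx (- A) = - flip_mx A by exact: linearN.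
rewrite flipD !mulNmx !flipN !flip_mxM !flip_mxK.
rewrite (flip_poly_samples a r) !(flip_poly_samples (a + s) 0) addn0.
rewrite (addnAC a r s) -/u addrC -opprD acc // deriv_comp.
have -> : u^`() = -1 by rewrite /u !derivE subr0 sub0r.
rewrite mulrN1 -mulmxN; congr (_ *m _).
by apply/matrixP => k l; rewrite !mxE hornerN opprK.
Qed.

Lemma interior_entryC (R : realType) (s i c : nat) :
  interior_entry R s c i = - interior_entry R s i c.
Proof.
rewrite /interior_entry.
case: (ltngtP i c) => _ /=; rewrite ?oppr0 //; case: ifP; rewrite ?opprK ?oppr0 //.
Qed.

(** The coupling blocks prescribed for the boundary rows are the continuation of
    the interior stencil; this is what makes them agree with the interior rows,
    through the antisymmetry [interior_entryC]. *)
Lemma left_couplingE (R : realType) (s r d b : nat) (e : (s + d = b)%N)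
    (k : 'I_r) (j : 'I_b) :
  castmx (erefl r, e) (row_mx (coupling_mx R s r) (0 : 'M_(r, d))) k j =
  interior_entry R s k (r + j).
Proof.
rewrite castmxE /= cast_ord_id.
have -> : (j : nat) = cast_ord (esym e) j by [].
have ltkr := ltn_ord k.
case: (split_ordP (cast_ord (esym e) j)) => l ->.
  rewrite row_mxEl mxE /interior_entry /=.
  have -> : (1 <= r + l - k <= s)%N = (k < r + l <= k + s)%N by lia.
  by case: ifP => // _; rewrite ifF //; lia.
by rewrite row_mxEr mxE /interior_entry /= !ifF //; lia.
Qed.

Lemma right_couplingE (R : realType) (s r d b : nat) (e : (d + s = b)%N)
    (k : 'I_r) (j : 'I_b) :
  castmx (erefl r, e) (row_mx (0 : 'M_(r, d)) (- flip_mx (coupling_mx R s r)))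
    k j = interior_entry R s (r + b + k) (r + j).
Proof.
rewrite castmxE /= cast_ord_id.
have -> : (j : nat) = cast_ord (esym e) j by [].
have ltkr := ltn_ord k.
case: (split_ordP (cast_ord (esym e) j)) => l ->.
  by rewrite row_mxEl mxE /interior_entry /= !ifF //; have := ltn_ord l; lia.
have ltls := ltn_ord l.
rewrite row_mxEr !mxE /interior_entry /= [in RHS]ifF; last by lia.
have -> : (r + (s - l.+1) - (r - k.+1) = r + b + k - (r + (d + l)))%N by lia.
have -> : (1 <= r + b + k - (r + (d + l)) <= s)%N =
          (r + (d + l) < r + b + k <= r + (d + l) + s)%N by lia.
by case: ifP => _; rewrite ?oppr0.
Qed.

(** * SBP operators and boundary closures *)

(** Left-multiplying the accuracy condition by P trades the inverse of Pt for
    Pt itself; the closure is then the upper part of P D w, where w samples the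
    monomials on the whole grid. *)
Lemma SBP_boundary_closure (R : realType) (s t r n : nat)
    (hn : (2 * r + s <= n)%N) (P D : 'M[R]_n) :
  (0 < r)%N -> is_SBP t hn P D ->
  exists Pt : 'M[R]_r, spd_mx Pt /\ exists B, boundary_closure s t Pt B.
Proof.
move=> r0 [Pt [Ph [[spdPt spdPh defP] _ acc energy]]].
move=> [B [Bh [Ch [Dt /= defD]]]].
exists Pt; split=> //; exists B.
move: Dt defP defD acc energy; rewrite /pad_right /pad_left.
(* With b = n - 2r abstracted, n can be replaced by r + (b + r), so that the
   outer casts become identities. *)
move: (sbp_dim hn) (left_dim hn) (right_dim hn).
move: (n - 2 * r - s)%N => d; move: (n - 2 * r)%N => b e el er Dt.
move: P D; clear hn; subst n => P D; rewrite !castmx_id.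
set C0 := castmx _ _; set Ch0 := castmx _ _.
set M := block3_mx B _ _ _ _ _ _ _ _ => defP defD acc energy.
have PD : P *m D = M.
  by rewrite defP defD block3_diag_mul /M block3_diag_mul mul1mx
    !mulKVmx ?spd_mx_unit // !mul1mx.
have symP : P^T = P.
  case: spdPt spdPh => symPt _ [symPh _].
  by rewrite defP tr_block3_mx symPt symPh trmx1 !trmx0.
have /(congr1 ulsubmx) := energy.
rewrite -[P in D^T *m P]symP -trmx_mul PD energy_block3 energy_corners //.
rewrite !block_mxKul => symB; split=> //.
pose w := monomial_samples R t 0 (r + (b + r)).
have accL : usubmx (D *m w) = deriv_samples R t 0 r.
  apply/matrixP => k m; rewrite 2!mxE [RHS]mxE add0n.
  have := acc (lshift (b + r) k) _ m; rewrite /= ltn_ord => /(_ isT) <- //.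
    by apply: eq_bigr => j _; rewrite [w _ _]mxE.
  by rewrite -ltnS.
have : usubmx (P *m (D *m w)) = usubmx (M *m w) by rewrite mulmxA PD.
rewrite -[D *m w]vsubmxK -[dsubmx _]vsubmxK accL defP block3_mul_col col_mxKu.
rewrite !mul0mx !addr0 => ->.
rewrite /w !monomial_samples_cat block3_mul_col col_mxKu mul0mx addr0.
rewrite (castmx_row_mulmx el _ (monomial_samples R t (0 + r))).
by rewrite monomial_samples_cat mul_row_col mul0mx addr0.
Qed.

(** P D is assembled from the left closure, the interior stencil and the
    reflected closure. *)
Lemma boundary_closure_SBP (R : realType) (s t r n : nat)
    (hn : (2 * r + s <= n)%N) (Pt B : 'M[R]_r) :
  (0 < r)%N -> spd_mx Pt -> boundary_closure s t Pt B ->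
  exists P D : 'M[R]_n, is_SBP t hn P D.
Proof.
move=> r0 spdPt closure; rewrite /is_SBP /pad_right /pad_left.
move: (sbp_dim hn) (left_dim hn) (right_dim hn).
move: (n - 2 * r - s)%N => d; move: (n - 2 * r)%N => b e el er.
clear hn; subst n.
pose Ph := flip_mx Pt; pose Bh := - flip_mx B.
pose Ch := - flip_mx (coupling_mx R s r).
pose C0 := castmx (erefl r, el) (row_mx (coupling_mx R s r) 0).
pose Ch0 := castmx (erefl r, er) (row_mx 0 Ch).
pose Dt : 'M[R]_b := \matrix_(i, j) interior_entry R s (r + i) (r + j).
pose P := block3_mx Pt 0 0 0 (1%:M : 'M_b) 0 0 0 Ph.
pose M := block3_mx B C0 0 (- C0^T) Dt (- Ch0^T) 0 Ch0 Bh.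
pose D := block3_mx (invmx Pt) 0 0 0 (1%:M : 'M_b) 0 0 0 (invmx Ph) *m M.
have spdPh : spd_mx Ph := spd_mx_flip spdPt.
have PD : P *m D = M.
  by rewrite /D /M block3_diag_mul block3_diag_mul mul1mx
    !mulKVmx ?spd_mx_unit // !mul1mx.
have symP : P^T = P.
  case: spdPt spdPh => symPt _ [symPh _].
  by rewrite tr_block3_mx symPt symPh trmx1 !trmx0.
have [symB accB] := closure.
exists P, D, Pt, Ph; split.
- by rewrite castmx_id.
- move=> i c; case: (split_ordP i) => [k ->|k ->].
    by rewrite /= leqNgt ltn_ord.
  case: (split_ordP k) => {k} [k ->|k ->] /=; last by lia.
  move=> _; rewrite /D /M block3_diag_mul !mul1mx /block3_mx.
  case: (split_ordP c) => [l ->|l ->].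
    by rewrite block_mxEdl col_mxEu [LHS]mxE [X in - X]mxE left_couplingE
               -interior_entryC.
  rewrite block_mxEdr; case: (split_ordP l) => {}l ->.
    by rewrite block_mxEul mxE.
  by rewrite block_mxEur [LHS]mxE [X in - X]mxE right_couplingE
             -interior_entryC /= addnA.
- pose w := monomial_samples R t 0 (r + (b + r)).
  have [Y Dw] : exists Y, D *m w =
      col_mx (deriv_samples R t 0 r) (col_mx Y (deriv_samples R t (r + b) r)).
    rewrite /D /M block3_diag_mul /w !monomial_samples_cat block3_mul_col.
    eexists; congr (col_mx _ (col_mx _ _)); rewrite !mulmx0 !mul0mx ?addr0 ?add0r.
      rewrite -!mulmxA -mulmxDr.
      rewrite (castmx_row_mulmx el _ (monomial_samples R t r)).
      rewrite monomial_samples_cat mul_row_col mul0mx addr0 accB.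
      by rewrite mulKmx ?spd_mx_unit.
    rewrite -!mulmxA -mulmxDr.
    rewrite (castmx_row_mulmx er _ (monomial_samples R t r)).
    rewrite monomial_samples_cat mul_row_col mul0mx add0r.
    have -> : (r + b = r + d + s)%N by rewrite -er addnA.
    by rewrite (boundary_closure_flip _ closure) mulKmx ?spd_mx_unit.
  move=> i bdi m lemt.
  transitivity ((D *m w) i (Ordinal (lemt : m < t.+1)%N)).
    by rewrite [RHS]mxE; apply: eq_bigr => j _; rewrite [w _ _]mxE.
  rewrite Dw; case: (split_ordP i) bdi => k -> /=.
    by rewrite col_mxEu mxE.
  rewrite col_mxEd; case: (split_ordP k) => {}k -> /=.
    by have := ltn_ord k; lia.
  by move=> _; rewrite col_mxEd mxE /= addnA.
- rewrite -[P in D^T *m P]symP -trmx_mul PD energy_block3 energy_corners //.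
  rewrite -symB; congr (block_mx _ _ _ (block_mx _ _ _ _)).
    by apply/matrixP => i j; rewrite !mxE interior_entryC addNr.
  rewrite /Bh linearN /= tr_flip_mx -opprD.
  have -> : flip_mx B + flip_mx B^T = flip_mx (B + B^T).
    by apply/matrixP => i j; rewrite !mxE.
  rewrite symB; apply/matrixP => i j; rewrite !mxE !big_ord1 !mxE opprK /=.
  have ltir := ltn_ord i; have ltjr := ltn_ord j.
  by congr ((nat_of_bool _)%:R * (nat_of_bool _)%:R); apply/eqP/eqP; lia.
- by exists B, Bh, Ch, Dt; rewrite castmx_id.
Qed.

Theorem theorem1 (R : realType) (s t r : nat)
    (hs : (0 < s)%N) (ht : (0 < t)%N) (hr : (0 < r)%N) (hsr : (s <= r)%N) :
  SBP_exists R s t r <->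
  exists Pt : 'M[R]_r,
    spd_mx Pt /\
    forall p q : nat, (p <= q)%N -> (q <= t)%N ->
      \sum_(k < r) \sum_(l < r)
        (q%:R * k%:R ^+ p * l%:R ^+ q.-1 + p%:R * k%:R ^+ q * l%:R ^+ p.-1)
          * Pt k l
      = \sum_(k < r) \sum_(l < s)
          (k%:R ^+ p * (r + l)%:R ^+ q + k%:R ^+ q * (r + l)%:R ^+ p)
            * coupling_mx R s r k l
        - (p == 0%N)%:R * (q == 0%N)%:R.
Proof.
split=> [/(_ _ (leqnn _)) [P [D sbp]]|[Pt [spdPt mom]] n hn].
  have [Pt [spdPt closure]] := SBP_boundary_closure hr sbp.
  by exists Pt; split=> //; apply/boundary_closureP.
have /boundary_closureP [//|B closure] : moment_conditions s t Pt by exact: mom.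
exact: boundary_closure_SBP closure.
Qed.
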